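(* Let $x\in(0,1/2]$. For all integers $n,t\ge 0$, $$d_{\rm TV}(X_t,X^{(n)}_t)=\left(\prod_{i=t+1}^{n+t}(1-x^i)\right)\left(1-\prod_{i=n+t+1}^\infty(1-x^i)\right),$$ and for each fixed $t\ge 0$, as $n\to\infty$, $$d_{\rm TV}(X_t,X^{(n)}_t)\sim\frac{C_t}{1-x}\,x^{n+t+1},\qquad\text{where } C_t=\prod_{i=t+1}^\infty(1-x^i).$$ For all integers $t<0$ and $n\ge 0$ with $n+t\ge 0$, $$d_{\rm TV}(X_t,X^{(n)}_t)=\left(\prod_{i=|t|+1}^{n}(1-x^i)\right)\left(1-\prod_{i=n+1}^\infty(1-x^i)\right),$$ and for each fixed $t<0$, as $n\to\infty$, $$d_{\rm TV}(X_t,X^{(n)}_t)\sim\frac{C_{|t|}}{1-x}\,x^{n+1}.$$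
   Context: $\mathbb{Z}_+=\{0,1,2,\dots\}$, $\mathbb{N}=\{1,2,\dots\}$. Let $x\in(0,1)$ and let $Z_1,Z_2,\dots$ be independent $\mathbb{Z}_+$-valued random variables with $\mathbb{P}(Z_i\ge k)=x^{ik}$ for $k=0,1,2,\dots$. Put $\mathbf{Z}=(Z_1,Z_2,\dots)$ and, for $n\ge 0$, $\mathbf{Z}^{(n)}=(Z_1,\dots,Z_n,0,0,\dots)$. Let $\Omega=\{\mathbf{z}\in(\mathbb{Z}_+)^{\mathbb{N}}: z_1+z_2+\cdots<\infty\}$; $\mathbf{Z}\in\Omega$ almost surely. The countdown map $\phi:\Omega\to(\mathbb{Z}_+)^{\mathbb{Z}}$ sends $\mathbf{z}$ to the unique sequence $(w_t)_{t\in\mathbb{Z}}$ with: $w_{t-1}-w_t\in\{0,1\}$ for all $t$; $\lim_{t\to\infty}(w_{-t}-t)=0$; $\lim_{t\to\infty}w_t=0$; and for each $i\ge1$ the number of $t\in\mathbb{Z}$ with $w_t=i$ equals $1+z_i$. Let $\mathbf{X}=(X_t)_{t\in\mathbb{Z}}=\phi(\mathbf{Z})$ and $\mathbf{X}^{(n)}=(X^{(n)}_t)_{t\in\mathbb{Z}}=\phi(\mathbf{Z}^{(n)})$. Total variation distance: $d_{\rm TV}(X,Y)=\sup_B|\mathbb{P}(X\in B)-\mathbb{P}(Y\in B)|$ over measurable $B$. $a_n\sim b_n$ means $\lim_{n\to\infty}a_n/b_n=1$. Empty products equal $1$. *)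

(* Defs.v *)
From HB Require Import structures.
From mathcomp Require Import all_boot all_order all_algebra.
From mathcomp Require Import finmap all_classical all_reals all_analysis.

Set Implicit Arguments.
Unset Strict Implicit.
Unset Printing Implicit Defensive.
Import Order.TTheory GRing.Theory Num.Theory.
Import numFieldNormedType.Exports.
Local Open Scope classical_set_scope.
Local Open Scope ring_scope.

(* Sequences z = (z_1, z_2, ...) are functions nat -> nat; the entry of index 0
   is never used. *)

Definition truncate_seq (n : nat) (z : nat -> nat) : nat -> nat :=
  fun i => if (i <= n)%N then z i else 0%N.

(* The limits are taken in R; the values of w are natural numbers, so neither
   the limits nor [phi] below depend on R. *)
Definition is_countdown (R : realType) (z : nat -> nat) (w : int -> nat) : Prop :=
  [/\ forall t : int,
        (w (t - 1))%:Z - (w t)%:Z = 0 \/ (w (t - 1))%:Z - (w t)%:Z = 1,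
      (fun k : nat => (w (- k%:Z))%:R - k%:R : R) @ \oo --> (0 : R),
      (fun k : nat => (w k%:Z)%:R : R) @ \oo --> (0 : R) &
      forall i : nat, (1 <= i)%N -> ([set t : int | w t = i] #= `I_((1 + z i)%N))%card].

(* If z_1 + z_2 + ... is finite, exactly one w satisfies [is_countdown R z];
   if the sum is infinite, no w does, and the value is the default sequence. *)
Definition phi (R : realType) (z : nat -> nat) : int -> nat :=
  xget (fun=> 0%N) [set w | is_countdown R z w].

(* Mutual independence of the subfamily (Z_i)_{i in I}. *)
Definition independent_RVs {d d'} {T : measurableType d} {T' : measurableType d'}
    {R : realType} (P : probability T R) (I : set nat)
    (Z : nat -> {RV P >-> T'}) : Prop :=
  forall (J : {fset nat}) (B : nat -> set T'),
    [set` J] `<=` I -> (forall i, measurable (B i)) ->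
    P (\bigcap_(i in [set` J]) (Z i @^-1` B i)) =
    (\prod_(i <- J) P (Z i @^-1` B i)%classic)%E.

(* Total variation distance between the laws of X and Y under P; it is meant
   for measurable X and Y. *)
Definition dTV {d d'} {T : measurableType d} {T' : measurableType d'}
    {R : realType} (P : probability T R) (X Y : T -> T') : R :=
  sup [set `|fine (P (X @^-1` B)) - fine (P (Y @^-1` B))|
      | B in [set B : set T' | measurable B]].

(* prod_{i >= m} (1 - x^i), as the limit of the partial products. *)
Definition qprod_inf {R : realType} (x : R) (m : nat) : R :=
  limn (fun N : nat => \prod_(m <= i < N) (1 - x ^+ i)).

Definition asymp_equiv {R : realType} (a b : nat -> R) : Prop :=
  (fun n => a n / b n) @ \oo --> (1 : R).

(* Main.v *)
Require Import Defs.
From HB Require Import structures.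
From mathcomp Require Import all_boot all_order all_algebra.
From mathcomp Require Import finmap all_classical all_reals all_analysis.
From mathcomp Require Import zify ring lra.

Set Implicit Arguments.
Unset Strict Implicit.
Unset Printing Implicit Defensive.
Import Order.TTheory GRing.Theory Num.Theory.
Import numFieldNormedType.Exports.
Local Open Scope classical_set_scope.
Local Open Scope ring_scope.

(** Read [z] as a partition with [z i] parts equal to [i], and let [S_j] be the
    number of its parts of size at least [j].  Counting the times at which the
    countdown path sits above a level gives, for [j >= 1],
      [j <= phi z t]  iff  [t + j <= S_j]
    ([phi_profile]): [phi z t] is the width [k] of the largest rectangle with
    sides [k] and [t + k] that fits in the partition, its Durfee rectangle.

    Write [t = b - a] and [n = a + v], where one of the naturals [a], [b] is 0.
    The path at time [t] never goes below [a], and cutting the partition along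
    its Durfee rectangle yields, with [(x)_m = (1 - x) ... (1 - x^m)],
      [P (X^(n)_t = a + l) =
         x^((a+l)(b+l)) (x)_(a+v) (x)_(b+v) / ((x)_(a+l) (x)_(b+l) (x)_(v-l))]
    for [l <= v] ([truncated_law]), and probability 0 at all other values.  When
    [v] increases by 1 this is multiplied by
      [(1 - x^(a+v+1)) (1 - x^(b+v+1)) / (1 - x^(v+1-l))],
    which for [l >= 1] and [x <= 1/2] is at least 1, because
    [(1 - x^(v+1))^2 >= 1 - 2 x^(v+1) >= 1 - x^v] ([durfee_law_incr]).  The law
    of [X_t] is the limit of these laws ([phi_law_cvg]), so [X_t] gives at least
    as much mass as [X^(n)_t] to every value except [a].  A single atom then
    carries the whole distance ([dTV_atom]):
      [d_TV = P (X^(n)_t = a) - P (X_t = a)].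
    At [l = 0] the formula collapses, as [a] or [b] is 0, to
    [(1 - x^(c+1)) ... (1 - x^(c+v))] with [c = a + b = |t|], and the difference
    with its limit is the announced product ([dTV_countdown]).  The asymptotics
    follow from [Q (1 + g) <= 1] and [1 - g <= Q] for [Q = prod_(i >= m) (1 - x^i)]
    and [g = x^m / (1 - x)] ([qprod_inf_bounds]). *)

(** * The countdown path and the tail sums *)

Definition zero_from (z : nat -> nat) (N : nat) : Prop :=
  forall i, (N <= i)%N -> z i = 0%N.

Definition tail_sum (z : nat -> nat) (j N : nat) : nat :=
  (\sum_(j <= i < N) z i)%N.

(** The bound [N] cuts off a tail of zeros of [z]; the path [w] is at
    level [j] or above exactly up to the time [S_j - j], with [S_j] the [j]-th
    tail sum. *)
Definition has_profile (z : nat -> nat) (N : nat) (w : int -> nat) : Prop :=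
  forall (j : nat) (t : int), (1 <= j)%N ->
    (j <= w t)%N = (t + j%:Z <= (tail_sum z j N)%:Z).

Lemma tail_sumS z j N : zero_from z N ->
  tail_sum z j N = (z j + tail_sum z j.+1 N)%N.
Proof.
move=> zN; rewrite /tail_sum; have [jN|Nj] := ltnP j N; first by rewrite big_ltn.
by rewrite !big_geq ?zN// ltnW.
Qed.

Lemma tail_sum_zero_from z j M N : zero_from z M -> zero_from z N ->
  tail_sum z j M = tail_sum z j N.
Proof.
wlog MN : M N / (M <= N)%N => [hwlog zM zN|zM zN].
  by case/orP: (leq_total M N) => h; [|symmetry]; exact: hwlog.
have [jM|Mj] := leqP j M.
  rewrite /tail_sum (big_cat_nat jM MN)//= [X in _ = (_ + X)%N]big_nat_cond.
  by rewrite [X in _ = (_ + X)%N]big1 ?addn0// => i /andP[/andP[Mi _] _]; exact: zM.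
rewrite /tail_sum big_geq ?(ltnW Mj)// big_nat_cond big1// => i.
by move=> /andP[/andP[ji _] _]; apply: zM; lia.
Qed.

Lemma leq_tail_sum z N j k : (j <= k)%N -> (tail_sum z k N <= tail_sum z j N)%N.
Proof.
move=> jk; have [kN|Nk] := leqP k N; last by rewrite /tail_sum big_geq// ltnW.
by rewrite /tail_sum (big_cat_nat jk kN)//= leq_addl.
Qed.

(** A level set of the path becomes, after a shift of time, an initial segment
    of [nat]; its cardinal then says where it ends. *)
Lemma downset_card (E : set nat) m :
  (forall e e', (e' <= e)%N -> E e -> E e') -> (E #= `I_m)%card -> E = `I_m.
Proof.
move=> Edown Em; apply/seteqP; split=> [e Ee|e /= em].
  rewrite /= ltnNge; apply/negP => me.
  have : (`I_m.+1 #<= `I_m)%card.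
    rewrite -(card_le_eqr Em); apply: subset_card_le => i /= im.
    by apply: Edown Ee; lia.
  by rewrite card_le_II ltnn.
apply: contrapT => nEe; have : (`I_m #<= `I_e)%card.
  rewrite -(card_le_eql Em); apply: subset_card_le => i /= Ei.
  by rewrite ltnNge; apply/negP => ei; apply/nEe/(Edown _ _ ei).
by rewrite card_le_II; lia.
Qed.

(** Integers that converge to 0 are eventually 0, so the two limits in the
    definition of the countdown say that the path is known near both ends. *)
Lemma intr_cvg0_eventually (R : realType) (u : nat -> R) (a : nat -> int) :
  (forall k, u k = (a k)%:~R) -> u @ \oo --> (0 : R) ->
  exists N, forall k, (N <= k)%N -> a k = 0.
Proof.
move=> ua /cvgrPdist_lt /(_ 1 ltr01)[N _ h]; exists N => k Nk.
have := h k Nk; rewrite /= ua sub0r normrN -intr_norm.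
by rewrite -[1]/(1%:~R) ltr_int; lia.
Qed.

Lemma cvg_eventually0 (R : realType) (u : nat -> R) N :
  (forall k, (N <= k)%N -> u k = 0) -> u @ \oo --> (0 : R).
Proof.
by move=> h; apply: cvg_near_cst; exists N => // k /= /h.
Qed.

(** The path is [- t] for [t <= - N0], hence [z] vanishes above [N0] and the claim
    holds at levels [k > N0].  Lower levels follow by descending induction: the path
    leaves level [k + 1] at time [tau] and stays [1 + z k] units at level [k]. *)
Lemma countdown_profile (R : realType) z w : is_countdown R z w ->
  exists N, zero_from z N /\ has_profile z N w.
Proof.
move=> [step lim_left lim_right card_level].
have [N0 hN0] : exists N, forall k, (N <= k)%N -> (w (- k%:Z))%:Z - k%:Z = 0.
  by apply: intr_cvg0_eventually lim_left => k; rewrite intrB.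
have wleft (t : int) : t <= - N0%:Z -> (w t)%:Z = - t.
  move=> tN; have := hN0 `|t|%N ltac:(lia).
  have -> : - `|t|%N%:Z = t by lia.
  lia.
have wdecr (t : int) (k : nat) : (w (t + k%:Z)%R <= w t)%N.
  elim: k => [|k IH]; first by rewrite addr0.
  apply: leq_trans IH; have := step (t + k.+1%:Z).
  have -> : t + k.+1%:Z - 1 = t + k%:Z by lia.
  lia.
have wmono (s t : int) : s <= t -> (w t <= w s)%N.
  move=> st; have := wdecr s (absz (t - s)%R).
  have -> : s + Posz (absz (t - s)%R) = t by lia.
  by [].
have z0 i : (N0 < i)%N -> z i = 0%N.
  move=> Ni; have lvl : [set t : int | w t = i] = [set - i%:Z].
    apply/seteqP; split => t /= wt.
      have [tN|Nt] := leP t (- N0%:Z); first by have := wleft t tN; lia.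
      have := wmono (- N0%:Z) t (ltW Nt); have := wleft (- N0%:Z) (lexx _); lia.
    by have := wleft t ltac:(lia); lia.
  have := card_level i ltac:(lia); rewrite lvl.
  rewrite (card_eql card_set1) => /card_eq_II; lia.
have zN : zero_from z N0.+1 by move=> i; exact: z0.
exists N0.+1; split => // j t j1.
have high k (s : int) : (N0 < k)%N ->
    (k <= w s)%N = (s + k%:Z <= (tail_sum z k N0.+1)%:Z).
  move=> Nk; rewrite /tail_sum big_geq//.
  have [sN|Ns] := leP s (- N0%:Z); first by have := wleft s sN; lia.
  have := wmono (- N0%:Z) s (ltW Ns); have := wleft (- N0%:Z) (lexx _); lia.
(* [N0 + 1 - i] is the lowest level reached after [i] descents. *)
suff main i : (i <= N0)%N -> forall k, (1 <= k)%N -> (N0.+1 - i <= k)%N ->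
    forall s, (k <= w s)%N = (s + k%:Z <= (tail_sum z k N0.+1)%:Z).
  have [jN|Nj] := leqP j N0; first by apply: (main N0) => //; lia.
  exact: high.
elim: i => [_|i IH iN] k k1 ik s; first by apply: high; lia.
have [ik'|ik2] := leqP (N0.+1 - i) k; first by apply: IH => //; lia.
have {}IH s' := IH ltac:(lia) k.+1 ltac:(lia) ltac:(lia) s'.
pose tau : int := (tail_sum z k.+1 N0.+1)%:Z - k.+1%:Z.
have tauP (s' : int) : (k.+1 <= w s')%N = (s' <= tau) by rewrite IH /tau; lia.
pose f (e : nat) : int := tau + 1 + e%:Z.
have E_eq : [set e | (k <= w (f e))%N] = `I_(1 + z k).
  apply: downset_card => [e e' ee' /= ke|].
    by apply: leq_trans ke _; apply: wmono; rewrite /f; lia.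
  rewrite -(card_eqr (card_level k k1)) card_eq_sym.
  have <- : f @` [set e | (k <= w (f e))%N] = [set t | w t = k].
    apply/seteqP; split => [_ [e /= ke <-]|u /= wu].
      by have := tauP (f e); rewrite /f in ke *; lia.
    have := tauP u => tu; exists (absz (u - tau - 1)%R); rewrite /= /f; last by lia.
    have -> : tau + 1 + Posz (absz (u - tau - 1)%R) = u by lia.
    lia.
  by apply: inj_card_eq => e e' _ _; rewrite /f; lia.
rewrite tail_sumS//; have [st|ts] := leP s tau.
  by have := tauP s; rewrite /tau in st *; lia.
have : [set e | (k <= w (f e))%N] (absz (s - tau - 1)%R) =
    `I_(1 + z k) (absz (s - tau - 1)%R).
  by rewrite E_eq.
rewrite /= /f; have -> : tau + 1 + Posz (absz (s - tau - 1)%R) = s by lia.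
move=> /propeqP h; apply/idP/idP; rewrite /tau in ts h *; lia.
Qed.

(** [w t] is the largest [j] with [t + j <= S_j]; such [j] form an initial
    segment since [S_j] is nonincreasing in [j]. *)
Lemma profile_exists z N : zero_from z N -> exists w, has_profile z N w.
Proof.
move=> zN.
pose p (t : int) (k : nat) := (k == 0%N) || (t + k%:Z <= (tail_sum z k N)%:Z).
have wt (t : int) : exists k, p t k /\ forall j, p t j -> (j <= k)%N.
  have pex : exists k, p t k by exists 0%N.
  have pub k : p t k -> (k <= N + `|t|)%N.
    rewrite /p; have [kN|Nk] := leqP k N; first by lia.
    by rewrite /tail_sum big_geq ?(ltnW Nk)//; lia.
  by case: (ex_maxnP pex pub) => k pk kmax; exists k.
have [w wP] := choice wt; exists w => j t j1; have [pk kmax] := wP t.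
apply/idP/idP => [jw|jS]; last by apply: kmax; rewrite /p jS orbT.
move: pk; rewrite /p; have := leq_tail_sum z N jw; lia.
Qed.

(** The level [i] is occupied at the times in [(S_(i+1) - i - 1, S_i - i]], an
    interval of [1 + z i] integers. *)
Lemma profile_countdown (R : realType) z N w : zero_from z N ->
  has_profile z N w -> is_countdown R z w.
Proof.
move=> zN wP.
have wP1 (t : int) : (w (t - 1)%R <= (w t).+1)%N.
  have [w2|w2] := ltnP (w (t - 1)) 2; first by lia.
  have := wP (w (t - 1)) (t - 1) ltac:(lia); have := wP (w (t - 1)).-1 t ltac:(lia).
  have := leq_tail_sum z N (leq_pred (w (t - 1))); lia.
have wP2 (t : int) : (w t <= w (t - 1)%R)%N.
  have [->//|w2] := posnP (w t).
  have := wP (w t) (t - 1) ltac:(lia); have := wP (w t) t ltac:(lia); lia.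
split.
- by move=> t; have := wP1 t; have := wP2 t; lia.
- apply: (@cvg_eventually0 _ _ N.+1) => k Nk; suff -> : w (- k%:Z) = k by rewrite subrr.
  have := wP k (- k%:Z) ltac:(lia); have := wP k.+1 (- k%:Z) ltac:(lia).
  by rewrite /tail_sum !big_geq; lia.
- apply: (@cvg_eventually0 _ _ (tail_sum z 1 N)) => k Nk.
  have -> : w k%:Z = 0%N; last by [].
  by have := wP 1%N k%:Z ltac:(lia); lia.
- move=> i i1; pose f (e : nat) : int := (tail_sum z i.+1 N)%:Z - i%:Z + e%:Z.
  have -> : [set t | w t = i] = f @` `I_(1 + z i).
    apply/seteqP; split => [t /= wt|_ [e /= ei <-]].
      have := wP i t i1; have := wP i.+1 t ltac:(lia).
      rewrite (tail_sumS i zN) => h1 h2.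
      by exists (absz (t - (tail_sum z i.+1 N)%:Z + i%:Z)%R); rewrite /f /=; lia.
    have := wP i (f e) i1; have := wP i.+1 (f e) ltac:(lia).
    by rewrite /f (tail_sumS i zN); lia.
  by apply: inj_card_eq => e e' _ _; rewrite /f; lia.
Qed.

Lemma phi_profile (R : realType) z N : zero_from z N -> has_profile z N (phi R z).
Proof.
move=> zN; have [w wP] := profile_exists zN.
have : is_countdown R z (phi R z).
  by apply: (@xgetI _ _ _ w); exact: profile_countdown wP.
move=> /countdown_profile[M [zM phiM]] j t j1.
by rewrite phiM// (tail_sum_zero_from j zM zN).
Qed.

(** This fixes [phi] on the null event where infinitely many [z i] are nonzero,
    without which [phi] could fail to be measurable there. *)
Lemma phi_default (R : realType) z : (forall N, ~ zero_from z N) ->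
  phi R z = fun=> 0%N.
Proof.
move=> nz; apply: xgetPN => w /countdown_profile[N [zN _]]; exact: nz zN.
Qed.

(** * Products of factors 1 - x^i *)

Definition qprod (R : realType) (x : R) (m n : nat) : R :=
  \prod_(m <= i < n) (1 - x ^+ i).

(** The Pochhammer symbol [(x; x)_n]. *)
Definition qpoch (R : realType) (x : R) (n : nat) : R := qprod x 1 n.+1.

(** The Gaussian binomial [N + m - 1] choose [m], that is, the sum of
    [x^(j_1 + ... + j_m)] over the multisets of [m] elements of [{0, ..., N - 1}].
    The recursion is on the multiplicity of the element 0, as in the sum of
    independent geometric variables. *)
Fixpoint qmultichoose (R : realType) (x : R) (N m : nat) : R :=
  if N is N'.+1 then \sum_(j < m.+1) x ^+ j * qmultichoose x N' j
  else (m == 0%N)%:R.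

(** The probability that the random partition with parts at most [a + v] has a
    Durfee rectangle with sides [a + l] and [b + l], for [l <= v]; the difference
    [b - a] of the sides is fixed. *)
Definition durfee_law (R : realType) (x : R) (a b v l : nat) : R :=
  x ^+ ((a + l) * (b + l)) * qpoch x (a + v) * qpoch x (b + v)
  / (qpoch x (a + l) * qpoch x (b + l) * qpoch x (v - l)).

Section qproducts.
Variables (R : realType) (x : R).
Hypotheses (x0 : 0 < x) (x1 : x < 1).

Lemma qfactor_gt0 i : (0 < i)%N -> 0 < 1 - x ^+ i.
Proof. by move=> i0; rewrite subr_gt0 exprn_ilt1 ?ltW// -lt0n. Qed.

Lemma qprod_recr m n : (m <= n)%N -> qprod x m n.+1 = qprod x m n * (1 - x ^+ n).
Proof. by move=> mn; rewrite /qprod big_nat_recr. Qed.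

Lemma qprod_cat m n p : (m <= n)%N -> (n <= p)%N ->
  qprod x m p = qprod x m n * qprod x n p.
Proof. by move=> mn np; rewrite /qprod (big_cat_nat mn np). Qed.

Lemma qprod_gt0 m n : (0 < m)%N -> 0 < qprod x m n.
Proof.
move=> m0; rewrite /qprod big_nat_cond; apply: prodr_gt0 => i /andP[/andP[mi _] _].
by apply: qfactor_gt0; exact: leq_trans mi.
Qed.

Lemma qpochS n : qpoch x n.+1 = qpoch x n * (1 - x ^+ n.+1).
Proof. exact: qprod_recr. Qed.

Lemma qpoch0 : qpoch x 0 = 1.
Proof. by rewrite /qpoch /qprod big_geq. Qed.

Lemma qpoch_gt0 n : 0 < qpoch x n.
Proof. exact: qprod_gt0. Qed.

Lemma qpoch_neq0 n : qpoch x n != 0.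
Proof. exact/lt0r_neq0/qpoch_gt0. Qed.

Lemma qprod_qpoch m n : qprod x m.+1 (m + n).+1 = qpoch x (m + n) / qpoch x m.
Proof.
rewrite /qpoch (@qprod_cat 1 m.+1 (m + n).+1)//; last by rewrite ltnS leq_addr.
by rewrite mulrC mulrA mulVf ?mul1r// gt_eqF// qprod_gt0.
Qed.

Lemma qmultichooseS0 N : qmultichoose x N.+1 0 = qmultichoose x N 0.
Proof. by rewrite [LHS]/= big_ord1 mul1r. Qed.

Lemma qmultichooseSS N m : qmultichoose x N.+1 m.+1 =
  qmultichoose x N.+1 m + x ^+ m.+1 * qmultichoose x N m.+1.
Proof. by rewrite [LHS]/= big_ord_recr. Qed.

(** The induction on [N] and [m] is Pascal's rule for Gaussian binomials. *)
Lemma qmultichooseE N m :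
  qmultichoose x N.+1 m = qpoch x (N + m) / (qpoch x N * qpoch x m).
Proof.
elim: N m => [|N IHN]; elim=> [|m IHm].
- by rewrite qmultichooseS0 addn0 qpoch0 mulr1 divr1.
- by rewrite qmultichooseSS {}IHm !add0n qpoch0 !mul1r mulr0 addr0 !divff ?qpoch_neq0.
- by rewrite qmultichooseS0 IHN qpoch0 !addn0 !mulr1 !divff ?qpoch_neq0.
- rewrite qmultichooseSS {}IHm IHN.
  rewrite !(addSn, addnS) !qpochS.
  have := qpoch_neq0 N; have := qpoch_neq0 m.
  have /lt0r_neq0 := @qfactor_gt0 N.+1 isT; have /lt0r_neq0 := @qfactor_gt0 m.+1 isT.
  have -> : x ^+ (N + m).+2 = x ^+ N.+1 * x ^+ m.+1 by rewrite -exprD addSn addnS.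
  move: (x ^+ N.+1) (x ^+ m.+1) => u v v1 u1 pm pN.
  by field; rewrite v1 u1 pm pN.
Qed.

(** The ratio of the two sides is [(1 - x^(a+v+1)) (1 - x^(b+v+1))] over
    [1 - x^(v+1-l)]; the factor lost by squaring [1 - x^(v+1)] is paid by
    [2 x <= 1], and [l >= 1] makes the denominator at most [1 - x^v]. *)
Lemma durfee_law_incr a b v l : x <= 1 / 2 -> (0 < l)%N -> (l <= v)%N ->
  durfee_law x a b v l <= durfee_law x a b v.+1 l.
Proof.
move=> xhalf l0 lv; rewrite /durfee_law subSn// !addnS !qpochS.
set F1 := 1 - x ^+ (a + v).+1; set F2 := 1 - x ^+ (b + v).+1.
set F3 := 1 - x ^+ (v - l).+1.
have F3_gt0 : 0 < F3 by exact: qfactor_gt0.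
set A := x ^+ _ * qpoch x (a + v) * qpoch x (b + v).
set B := qpoch x (a + l) * qpoch x (b + l) * qpoch x (v - l).
have B_gt0 : 0 < B by rewrite !mulr_gt0// qpoch_gt0.
have A_gt0 : 0 < A by rewrite !mulr_gt0// ?qpoch_gt0// exprn_gt0.
have -> : x ^+ ((a + l) * (b + l)) * (qpoch x (a + v) * F1) * (qpoch x (b + v) * F2)
   / (qpoch x (a + l) * qpoch x (b + l) * (qpoch x (v - l) * F3))
   = A / B * (F1 * F2 / F3).
  rewrite /A /B; have := qpoch_neq0 (a + l); have := qpoch_neq0 (b + l).
  have := qpoch_neq0 (v - l); have := lt0r_neq0 F3_gt0 => h1 h2 h3 h4.
  by field; rewrite h1 h2 h3 h4.
apply: ler_peMr; [by rewrite divr_ge0 ?ltW|rewrite ler_pdivlMr// mul1r].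
have hx i j : (i <= j)%N -> x ^+ j <= x ^+ i.
  by move=> ij; apply: ler_wiXn2l; rewrite ?ltW.
have h1 : 1 - x ^+ v.+1 <= F1 by rewrite lerB// hx//; lia.
have h2 : 1 - x ^+ v.+1 <= F2 by rewrite lerB// hx//; lia.
have h3 : F3 <= 1 - x ^+ v by rewrite lerB// hx//; lia.
have h0 : 0 < 1 - x ^+ v.+1 by exact: qfactor_gt0.
have := ler_pM (ltW h0) (ltW h0) h1 h2; apply: le_trans; apply: le_trans h3 _.
have : x ^+ v.+1 <= x ^+ v / 2 by rewrite exprS mulrC ler_pM2l ?exprn_gt0// -div1r.
have : 0 < x ^+ v.+1 by rewrite exprn_gt0.
move: (x ^+ v.+1) (x ^+ v) => y z; nra.
Qed.

Lemma durfee_law0 a b v : a = 0%N \/ b = 0%N ->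
  durfee_law x a b v 0 = qprod x (a + b).+1 (a + b + v).+1.
Proof.
move=> ab; rewrite qprod_qpoch /durfee_law !addn0 subn0.
have -> : (a * b = 0)%N by case: ab => ->; rewrite ?muln0.
have := qpoch_neq0 v; have := qpoch_neq0 (a + b).
by case: ab => ->; rewrite ?add0n ?addn0 expr0 qpoch0 => h1 h2; field; rewrite h1 h2.
Qed.

Lemma qprod_ge0 m n : (0 < m)%N -> 0 <= qprod x m n.
Proof. by move=> m0; exact/ltW/qprod_gt0. Qed.

Lemma qprod_le1 m n : (0 < m)%N -> qprod x m n <= 1.
Proof.
move=> m0; rewrite /qprod big_nat_cond; apply: prodr_ile1 => i /andP[/andP[mi _] _].
by rewrite ltW ?qfactor_gt0 ?(leq_trans m0)//= gerBl exprn_ge0 ?ltW.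
Qed.

Lemma qprod_cvg m : (0 < m)%N -> qprod x m @ \oo --> qprod_inf x m.
Proof.
move=> m0; apply: nonincreasing_is_cvgn; last first.
  by exists 0 => _ [n _ <-]; exact: qprod_ge0.
apply/nonincreasing_seqP => n; have [mn|nm] := leqP m n.
  by rewrite qprod_recr// ler_piMr ?qprod_ge0// gerBl exprn_ge0 ?ltW.
by rewrite /qprod !big_geq// ltnW.
Qed.

Lemma qprod_mul_inf m n : (0 < m)%N -> (m <= n)%N ->
  qprod x m n * qprod_inf x n = qprod_inf x m.
Proof.
move=> m0 mn; apply/esym/cvg_lim => //.
have h : qprod x m n * qprod x n N @[N --> \oo] --> qprod x m n * qprod_inf x n.
  by apply: (cvgM (cvg_cst _)); apply: qprod_cvg; exact: leq_trans mn.
apply: cvg_trans h; apply: near_eq_cvg; exists n => // N /= nN.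
by rewrite -qprod_cat.
Qed.

(** With [G = x^m + ... + x^(n-1)] both inequalities are stable when a factor
    [1 - y] is added: [(1 - G) (1 - y) >= 1 - G - y], which is [1 - (G + y)], and
    [(1 - y) (1 + G + y) <= 1 + G]. *)
Lemma qprod_bounds m n : (0 < m)%N -> (m <= n)%N ->
  1 - (x ^+ m - x ^+ n) / (1 - x) <= qprod x m n /\
  qprod x m n * (1 + (x ^+ m - x ^+ n) / (1 - x)) <= 1.
Proof.
move=> m0; elim: n => [|n IH]; first by lia.
rewrite leq_eqVlt => /orP[/eqP <-|].
  by rewrite subrr mul0r /qprod big_geq// subr0 addr0 mulr1.
rewrite ltnS => mn; have [h1 h2] := IH mn; rewrite qprod_recr//.
have x1' : 1 - x != 0 by rewrite subr_eq0 eq_sym lt_eqF.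
have -> : (x ^+ m - x ^+ n.+1) / (1 - x) = (x ^+ m - x ^+ n) / (1 - x) + x ^+ n.
  by rewrite exprS; field.
have G0 : 0 <= (x ^+ m - x ^+ n) / (1 - x).
  by rewrite divr_ge0 ?subr_ge0 ?ler_wiXn2l// ltW.
have y0 : 0 < x ^+ n by rewrite exprn_gt0.
have Q0 := qprod_gt0 n m0; have Q1 := qprod_le1 n m0.
move: G0 y0 h1 h2 Q0 Q1; move: ((x ^+ m - x ^+ n) / (1 - x)) => G.
move: (x ^+ n) (qprod x m n).
move=> y Q G0 y0 h1 h2 Q0 Q1.
split; first by nra.
have -> : Q * (1 - y) * (1 + (G + y)) = Q * (1 + G) - Q * y * (G + y) by ring.
by apply: le_trans h2; rewrite gerBl !mulr_ge0// ?addr_ge0// ltW.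
Qed.

Lemma expx_cvg0 : (fun n => x ^+ n) @ \oo --> (0 : R).
Proof. by apply: cvg_expr; rewrite gtr0_norm. Qed.

Lemma qprod_inf_bounds m : (0 < m)%N ->
  1 - x ^+ m / (1 - x) <= qprod_inf x m /\
  qprod_inf x m * (1 + x ^+ m / (1 - x)) <= 1.
Proof.
move=> m0.
have g : (x ^+ m - x ^+ n) / (1 - x) @[n --> \oo] --> x ^+ m / (1 - x).
  have -> : x ^+ m / (1 - x) = (x ^+ m - 0) / (1 - x) by rewrite subr0.
  by apply: cvgM; last exact: cvg_cst; apply: cvgB; [exact: cvg_cst|exact: expx_cvg0].
split.
- apply: (ler_cvg_to (cvgB (cvg_cst (1 : R)) g) (qprod_cvg m0)).
  by exists m => // n /= mn; have [] := qprod_bounds m0 mn.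
- apply: (cvgr_to_le (cvgM (qprod_cvg m0) (cvgD (cvg_cst (1 : R)) g))).
  by exists m => // n /= mn; have [] := qprod_bounds m0 mn.
Qed.

(** At [m = 1] and [x = 1/2] the lower bound of [qprod_inf_bounds] is 0, hence
    the detour by [m + 1]. *)
Lemma qprod_inf_gt0 m : x <= 1 / 2 -> (0 < m)%N -> 0 < qprod_inf x m.
Proof.
move=> xhalf m0; rewrite -(qprod_mul_inf m0 (leqnSn m)) mulr_gt0 ?qprod_gt0//.
have [+ _] := @qprod_inf_bounds m.+1 isT; apply: lt_le_trans.
rewrite subr_gt0 ltr_pdivrMr ?subr_gt0// mul1r.
have : x ^+ m.+1 <= x ^+ 2 by apply: ler_wiXn2l; rewrite ?ltW.
have : x * x <= x * (1 / 2) by rewrite ler_pM2l.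
rewrite expr2; move: (x ^+ m.+1) (x * x) => u v; lra.
Qed.

(** [qprod_inf_bounds] gives [1 - g <= (1 - Q) / g <= 1] with
    [g = x^(c+v+1) / (1 - x)], since [1 - Q >= Q g] and [Q >= 1 - g]. *)
Lemma qprod_asymp c : x <= 1 / 2 ->
  asymp_equiv (fun v => qprod x c.+1 (c + v).+1 * (1 - qprod_inf x (c + v).+1))
              (fun v => qprod_inf x c.+1 / (1 - x) * x ^+ (c + v).+1).
Proof.
move=> xhalf; rewrite /asymp_equiv.
have C_gt0 : 0 < qprod_inf x c.+1 by exact: qprod_inf_gt0.
have xx : 1 - x != 0 by rewrite subr_eq0 eq_sym lt_eqF.
have shift (u : nat -> R) (l : R) :
    u @ \oo --> l -> u (c + v).+1 @[v --> \oo] --> l.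
  move=> ul; have -> : (fun v => u (c + v).+1) = [sequence u (v + c.+1)%N]_v.
    by apply/funext => v /=; rewrite addnS addnC.
  by rewrite cvg_shiftn.
have ratio_cvg : (1 - qprod_inf x (c + v).+1) / (x ^+ (c + v).+1 / (1 - x)) @[v --> \oo]
    --> (1 : R).
  apply: (@squeeze_cvgr _ _ _ _ (fun v => 1 - x ^+ (c + v).+1 / (1 - x)) (fun=> 1)).
  - apply: nearW => v; have [h1 h2] := @qprod_inf_bounds (c + v).+1 isT.
    have y0 : 0 < x ^+ (c + v).+1 / (1 - x) by rewrite divr_gt0 ?exprn_gt0 ?subr_gt0.
    move: y0 h1 h2; move: (x ^+ (c + v).+1 / (1 - x)) => y.
    move: (qprod_inf _ _) => Q y0 h1 h2.
    by rewrite ler_pdivlMr// ler_pdivrMr// mul1r; apply/andP; split; nra.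
  - rewrite -[X in _ --> X]subr0; apply: cvgB; first exact: cvg_cst.
    rewrite -[X in _ --> X](mul0r (1 - x)^-1).
    by apply: cvgM; [apply: (shift (fun n => x ^+ n)); exact: expx_cvg0|exact: cvg_cst].
  - exact: cvg_cst.
have prod_cvg : qprod x c.+1 (c + v).+1 / qprod_inf x c.+1 @[v --> \oo] --> (1 : R).
  rewrite -[X in _ --> X](divff (lt0r_neq0 C_gt0)).
  by apply: cvgM; [apply: shift; exact: qprod_cvg|exact: cvg_cst].
rewrite -[X in _ --> X](mulr1 1).
apply: cvg_trans (cvgM prod_cvg ratio_cvg); apply: near_eq_cvg; apply: nearW => v /=.
have := lt0r_neq0 C_gt0; have : x ^+ (c + v).+1 != 0 by rewrite expf_neq0 ?lt0r_neq0.
by move=> h1 h2; field; rewrite h1 h2 xx.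
Qed.

Lemma qprod_gap c v :
  qprod x c.+1 (c + v).+1 - qprod_inf x c.+1 =
  qprod x c.+1 (c + v).+1 * (1 - qprod_inf x (c + v).+1).
Proof.
rewrite mulrBr mulr1 qprod_mul_inf//; lia.
Qed.
End qproducts.

(** * Probabilities as real numbers, and an atom that carries the distance *)

Definition prob d (T : measurableType d) (R : realType) (P : probability T R)
  (A : set T) : R := fine (P A).

(** Measurability of a function with values in [nat], in the form that is checked
    for the countdown paths. *)
Definition level_measurable d (T : measurableType d) (Y : T -> nat) : Prop :=
  forall k, measurable [set a | Y a = k].

Section prob_basics.
Context d (T : measurableType d) (R : realType) (P : probability T R).
Implicit Types (A B : set T) (Y : T -> nat).

Lemma probE A : measurable A -> P A = (prob P A)%:E.
Proof. by move=> mA; rewrite /prob fineK// fin_num_measure. Qed.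

Lemma prob_ge0 A : 0 <= prob P A.
Proof. by rewrite /prob fine_ge0. Qed.

Lemma probT : prob P setT = 1.
Proof. by rewrite /prob probability_setT. Qed.

Lemma prob0 : prob P set0 = 0.
Proof. by rewrite /prob measure0. Qed.

Lemma probU A B : measurable A -> measurable B -> A `&` B = set0 ->
  prob P (A `|` B) = prob P A + prob P B.
Proof.
by move=> mA mB AB; rewrite /prob measureU// fineD// fin_num_measure.
Qed.

Lemma probC A : measurable A -> prob P (~` A) = 1 - prob P A.
Proof. by move=> mA; rewrite /prob probability_setC// fineB// fin_num_measure. Qed.

Lemma le_prob A B : measurable A -> measurable B -> A `<=` B ->
  prob P A <= prob P B.
Proof.
move=> mA mB AB; rewrite /prob fine_le ?fin_num_measure//.
by apply: le_measure; rewrite ?inE.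
Qed.

Lemma preimage_measurable Y (B : set nat) : level_measurable Y ->
  measurable (Y @^-1` B).
Proof.
move=> mY; have -> : Y @^-1` B = \bigcup_(k in B) [set a | Y a = k].
  by apply/seteqP; split=> [a Ba|a [k Bk /= ak]]; [exists (Y a)|rewrite /preimage /= ak].
by apply: bigcup_measurable => k _; exact: mY.
Qed.

Lemma preimage2_measurable Y1 Y2 (Q : nat -> nat -> Prop) :
  level_measurable Y1 -> level_measurable Y2 ->
  measurable [set a | Q (Y1 a) (Y2 a)].
Proof.
move=> mY1 mY2; have -> : [set a | Q (Y1 a) (Y2 a)] =
    \bigcup_k ([set a | Y1 a = k] `&` Y2 @^-1` [set j | Q k j]).
  apply/seteqP; split=> [a Qa|a [k _ [/= <-]]//]; by exists (Y1 a).
apply: bigcupT_measurable => k; apply: measurableI; first exact: mY1.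
exact: preimage_measurable.
Qed.

Lemma sum_level_measurable (Z : nat -> T -> nat) j n :
  (forall i, level_measurable (Z i)) ->
  level_measurable (fun a => \sum_(j <= i < n) Z i a)%N.
Proof.
move=> mZ; elim: n => [|n IH] k.
  rewrite [X in measurable X](_ : _ = [set a | (fun=> 0 = k)%N a])//.
    have [->|/eqP k0] := eqVneq k 0%N.
      by rewrite (_ : [set _ | _] = setT)//; apply/seteqP; split.
    rewrite (_ : [set _ | _] = set0)//; apply/seteqP; split=> // a /= e.
    by apply: k0; rewrite -e.
  by apply/seteqP; split => a /=; rewrite big_geq.
have [jn|nj] := leqP j n; last first.
  have := IH k; congr measurable; apply/seteqP.
  by split=> a /=; rewrite !big_geq// ltnW.
rewrite [X in measurable X](_ : _ =
  [set a | (\sum_(j <= i < n) Z i a + Z n a)%N = k]).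
  exact: (@preimage2_measurable _ _ (fun s t => (s + t)%N = k)).
by apply/seteqP; split => a /=; rewrite big_nat_recr.
Qed.

Lemma prob_slices A Y n : measurable A -> level_measurable Y ->
  prob P (A `&` [set a | (Y a < n)%N]) =
  \sum_(k < n) prob P (A `&` [set a | Y a = k]).
Proof.
move=> mA mY; elim: n => [|n IH].
  rewrite big_ord0 (_ : _ `&` _ = set0) ?prob0//.
  by apply/seteqP; split=> // a [].
rewrite big_ord_recr/= -IH -probU.
- congr prob; rewrite -setIUr; congr (_ `&` _); apply/seteqP; split => a /=.
    by rewrite ltnS leq_eqVlt => /orP[/eqP|]; [right|left].
  by case=> [|->]; rewrite ltnS// => /ltnW.
- by apply: measurableI => //; apply: (preimage_measurable [set j | (j < n)%N]).
- by apply: measurableI.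
- by apply/seteqP; split=> // a /= [[_ +] [_ e]]; rewrite e ltnn.
Qed.

Lemma prob_dist A B C : measurable A -> measurable B -> measurable C ->
  A `&` ~` C = B `&` ~` C -> `|prob P A - prob P B| <= prob P C.
Proof.
move=> mA mB mC ABC.
have half U V : measurable U -> measurable V -> U `&` ~` C = V `&` ~` C ->
    prob P U <= prob P V + prob P C.
  move=> mU mV UVC; have -> : prob P V + prob P C =
      prob P V + prob P (C `\` V) + prob P (C `&` V).
    rewrite -addrA; congr (_ + _); rewrite -probU; last 3 first.
    - exact: measurableD.
    - exact: measurableI.
    - by apply/seteqP; split=> // a [[_ nV] [_ /nV]].
    by congr prob; rewrite setUC setUIDK.
  rewrite -probU//; last 2 first.
  - exact: measurableD.
  - by apply/seteqP; split=> // a [Va [_ /(_ Va)]].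
  rewrite -[X in X <= _]addr0 lerD ?prob_ge0// le_prob//.
    by apply: measurableU => //; exact: measurableD.
  move=> a Ua; have [Va|nVa] := pselect (V a); [by left|right].
  split=> //; apply: contrapT => nCa; have : (V `&` ~` C) a by rewrite -UVC.
  by case.
by rewrite ler_distlC lerBlDr; apply/andP; split; apply: half.
Qed.

(** Countable additivity over the atoms of [B]. *)
Lemma prob_le_atoms (X Y : T -> nat) (B : set nat) :
  level_measurable X -> level_measurable Y ->
  (forall k, B k -> prob P [set a | Y a = k] <= prob P [set a | X a = k]) ->
  prob P (Y @^-1` B) <= prob P (X @^-1` B).
Proof.
move=> mX mY YX.
have decomp (W : T -> nat) : W @^-1` B = \bigcup_(k in B) [set a | W a = k].
  by apply/seteqP; split=> [a Ba|a [k Bk /= ak]]; [exists (W a)|rewrite /preimage /= ak].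
rewrite -lee_fin -!probE; [|exact: preimage_measurable..].
rewrite !decomp !measure_bigcup//; first last.
- by move=> i j _ _ [a [/= <- <-]].
- by move=> i j _ _ [a [/= <- <-]].
apply: lee_nneseries => [k _ _|k /set_mem Bk]; first exact: measure_ge0.
by have := YX k Bk; rewrite -lee_fin -!probE.
Qed.

(** Off [k0], [X] dominates [Y], so among the sets that avoid [k0] the difference
    of the two laws is largest on the complement of [k0]; sets that contain [k0]
    are handled by passing to complements. *)
Lemma dTV_atom (X Y : T -> nat) k0 :
  level_measurable X -> level_measurable Y ->
  (forall k, k <> k0 -> prob P [set a | Y a = k] <= prob P [set a | X a = k]) ->
  dTV P X Y = prob P [set a | Y a = k0] - prob P [set a | X a = k0].
Proof.
move=> mX mY YX; have mp (W : T -> nat) (B : set nat) :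
    level_measurable W -> measurable (W @^-1` B).
  exact: preimage_measurable.
have compl (W : T -> nat) (B : set nat) : level_measurable W ->
    prob P (W @^-1` (~` B)) = 1 - prob P (W @^-1` B).
  by move=> mW; rewrite preimage_setC probC//; exact: mp.
set g := _ - _.
(* The complement of [k0] is the union of [B] and the complement of [k0 |` B]. *)
have split_at (W : T -> nat) (B : set nat) : level_measurable W -> ~ B k0 ->
    prob P (W @^-1` B) + prob P (W @^-1` (~` (k0 |` B))) = 1 - prob P [set a | W a = k0].
  move=> mW nB; rewrite compl// (_ : W @^-1` (k0 |` B) = [set a | W a = k0] `|` W @^-1` B)//.
  rewrite probU//; first by lra.
    exact: mp.
  by apply/seteqP; split=> // a [/= -> /nB].
have le_off (B : set nat) : ~ B k0 -> `|prob P (X @^-1` B) - prob P (Y @^-1` B)| <= g.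
  move=> nB; have h1 : prob P (Y @^-1` B) <= prob P (X @^-1` B).
    by apply: prob_le_atoms => // k Bk; apply: YX => ek; apply: nB; rewrite -ek.
  rewrite ger0_norm ?subr_ge0//.
  have h2 : prob P (Y @^-1` (~` (k0 |` B))) <= prob P (X @^-1` (~` (k0 |` B))).
    by apply: prob_le_atoms => // k nk; apply: YX => ek; apply: nk; left.
  by have := split_at X B mX nB; have := split_at Y B mY nB; rewrite /g; lra.
have le_all (B : set nat) : `|prob P (X @^-1` B) - prob P (Y @^-1` B)| <= g.
  have [Bk|] := pselect (B k0); last exact: le_off.
  have := @le_off (~` B) (fun n => n Bk); rewrite !compl//.
  by rewrite (_ : 1 - _ - _ = - (prob P (X @^-1` B) - prob P (Y @^-1` B))) ?normrN//; lra.
have g0 : 0 <= g by apply: le_trans (le_all set0).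
have mem_g : [set `|fine (P (X @^-1` B)) - fine (P (Y @^-1` B))|
      | B in [set B : set nat | measurable B]] g.
  exists [set k0] => //; rewrite distrC -[RHS]ger0_norm//.
rewrite /dTV; apply/eqP; rewrite eq_le; apply/andP; split.
  by apply: ge_sup; [exists g|move=> _ [B _ <-]; exact: le_all].
by apply: ub_le_sup => //; exists g => _ [B _ <-]; exact: le_all.
Qed.

End prob_basics.

(** * The law of the truncated countdown *)

Section geometric_family.
Context d (T : measurableType d) (R : realType) (P : probability T R) (x : R)
  (Z : nat -> {RV P >-> nat}).
Hypotheses (x0 : 0 < x) (x1 : x < 1)
  (Z_indep : independent_RVs [set i | (1 <= i)%N] Z)
  (Z_law : forall i k : nat, (1 <= i)%N ->
     P [set a | (k <= Z i a)%N] = (x ^+ (i * k))%:E).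

Lemma Z_level_measurable i : level_measurable (Z i).
Proof. by move=> k; exact: (measurable_funPTI (Z i) (Y := [set k])). Qed.

Lemma prob_Z_ge i k : (1 <= i)%N -> prob P [set a | (k <= Z i a)%N] = x ^+ (i * k).
Proof. by move=> i1; rewrite /prob Z_law. Qed.

Lemma prob_Z_eq i k : (1 <= i)%N ->
  prob P [set a | Z i a = k] = x ^+ (i * k) * (1 - x ^+ i).
Proof.
move=> i1; have mge j : measurable [set a | (j <= Z i a)%N].
  exact: (preimage_measurable [set m | (j <= m)%N] (@Z_level_measurable i)).
have := prob_Z_ge k i1; rewrite (_ : [set a | (k <= Z i a)%N] =
    [set a | Z i a = k] `|` [set a | (k.+1 <= Z i a)%N]); last first.
  apply/seteqP; split=> a /=.
    by rewrite leq_eqVlt => /orP[/eqP|]; [left|right].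
  by case=> [->//|/ltnW].
rewrite probU//; first by rewrite prob_Z_ge// mulnS exprD; lra.
  exact: Z_level_measurable.
by apply/seteqP; split=> // a /= [->]; rewrite ltnn.
Qed.

Definition cylinder (k : nat) (B : nat -> set nat) : set T :=
  [set a | forall i, (1 <= i <= k)%N -> B i (Z i a)].

Lemma cylinder_measurable k B : measurable (cylinder k B).
Proof.
rewrite (_ : cylinder k B = \bigcap_(i in [set i | (1 <= i <= k)%N]) Z i @^-1` B i).
  by apply: bigcap_measurableType => i _; exact/preimage_measurable/Z_level_measurable.
by apply/seteqP; split => a h i /h.
Qed.

Lemma prob_cylinder k B :
  prob P (cylinder k B) = \prod_(1 <= i < k.+1) prob P (Z i @^-1` B i).
Proof.
pose J : {fset nat} := [fset i in index_iota 1 k.+1]%fset.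
have JE i : (i \in J) = (1 <= i <= k)%N by rewrite in_fset/= mem_index_iota ltnS.
have := Z_indep (J := J) (B := B) _ _; rewrite /prob.
rewrite (_ : \bigcap_(i in [set` J]) _ = cylinder k B); last first.
  by apply/seteqP; split => a h i; have := h i; rewrite /= JE.
move=> -> //; last by move=> i /=; rewrite JE => /andP[].
rewrite (perm_big (index_iota 1 k.+1))/=; last first.
  apply: uniq_perm; rewrite ?fset_uniq ?iota_uniq// => i.
  by rewrite -[LHS]/(i \in J) JE mem_index_iota ltnS.
rewrite (eq_bigr (fun i => (prob P (Z i @^-1` B i))%:E)) ?prodEFin// => i _.
exact/probE/preimage_measurable/Z_level_measurable.
Qed.

(** The sum of [Z (k+1), ..., Z (k+N)] is independent of [Z 1, ..., Z k] and has a
    negative binomial law in the sense of q-analogues.  Keeping the cylinder in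
    the statement lets the induction absorb [Z (k+1)] into it, so that the
    product rule for cylinders is the only form of independence needed. *)
Lemma prob_cylinder_sum k N m B :
  prob P (cylinder k B `&` [set a | (\sum_(k.+1 <= i < (k + N).+1) Z i a)%N = m]) =
  prob P (cylinder k B) *
    (qprod x k.+1 (k + N).+1 * x ^+ (k.+1 * m) * qmultichoose x N m).
Proof.
elim: N k m B => [|N IH] k m B.
  rewrite addn0 /qprod big_geq// mul1r /=; have [->|m0] := eqVneq m 0%N.
    rewrite muln0 !mulr1; congr prob; apply/seteqP; split=> [a []//|a ca].
    by split=> //=; rewrite big_geq.
  rewrite !mulr0 (_ : _ `&` _ = set0) ?prob0//; apply/seteqP; split=> // a [_ /=].
  by rewrite big_geq// => m0'; move: m0; rewrite -m0'.
set A := _ `&` _.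
have mS j n : level_measurable (fun a => \sum_(j <= i < n) Z i a)%N.
  by apply: sum_level_measurable => i; exact: Z_level_measurable.
have mA : measurable A by apply: measurableI; [exact: cylinder_measurable|exact: mS].
have SE a : (\sum_(k.+1 <= i < (k + N.+1).+1) Z i a =
    Z k.+1 a + \sum_(k.+2 <= i < (k.+1 + N).+1) Z i a)%N.
  by rewrite big_ltn ?addSnnS//; lia.
have -> : A = A `&` [set a | (Z k.+1 a < m.+1)%N].
  by apply/seteqP; split=> a; [move=> [ca /= h]; split=> //=; rewrite ltnS -h SE leq_addr|case].
rewrite prob_slices//; last exact: Z_level_measurable.
pose Bc c i := if i == k.+1 then [set c] else B i.
have slice (c : 'I_m.+1) : prob P (A `&` [set a | Z k.+1 a = c]) =
    prob P (cylinder k B) * (x ^+ (k.+1 * c) * (1 - x ^+ k.+1)) *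
    (qprod x k.+2 (k.+1 + N).+1 * x ^+ (k.+2 * (m - c)) * qmultichoose x N (m - c)).
  have -> : A `&` [set a | Z k.+1 a = c] = cylinder k.+1 (Bc c) `&`
      [set a | (\sum_(k.+2 <= i < (k.+1 + N).+1) Z i a)%N = (m - c)%N].
    apply/seteqP; split=> a.
      move=> [[ca /=]]; rewrite SE => h Zc; split => /=; last by lia.
      move=> i /andP[i1 ik]; rewrite /Bc; case: eqP => [->//|/eqP ik'].
      by apply: ca; lia.
    move=> [ca /= h]; have Zc : Z k.+1 a = c.
      by have := ca k.+1; rewrite /Bc eqxx; apply; rewrite leqnn.
    split=> //; split=> /=; last by rewrite SE; have := ltn_ord c; lia.
    by move=> i ik; have := ca i; rewrite /Bc; case: eqP => [?|_]; [lia|apply; lia].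
  rewrite IH; congr (_ * _); rewrite !prob_cylinder big_nat_recr//=; congr (_ * _).
    apply: eq_big_nat => i ik; rewrite /Bc; case: eqP => // ?; lia.
  by rewrite /Bc eqxx -prob_Z_eq.
rewrite (eq_bigr _ (fun c _ => slice c)).
have -> : qprod x k.+1 (k + N.+1).+1 = (1 - x ^+ k.+1) * qprod x k.+2 (k.+1 + N).+1.
  by rewrite /qprod big_ltn ?addSnnS//; lia.
have -> : qmultichoose x N.+1 m = \sum_(c < m.+1) x ^+ (m - c) * qmultichoose x N (m - c).
  by rewrite [LHS]/= (reindex_inj rev_ord_inj); apply: eq_bigr => c _; rewrite /= subSS.
rewrite !mulr_sumr; apply: eq_bigr => c _.
have -> : x ^+ (k.+1 * m) = x ^+ (k.+1 * c) * x ^+ (k.+1 * (m - c)).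
  by rewrite -exprD -mulnDr subnKC// -ltnS.
by rewrite [(k.+2 * _)%N]mulSn exprD; ring.
Qed.

Lemma truncated_profile n a j t : (1 <= j)%N ->
  (j <= phi R (truncate_seq n (fun i => Z i a)) t)%N =
  (t + j%:Z <= (\sum_(j <= i < n.+1) Z i a)%N%:Z).
Proof.
move=> j1; have zn : zero_from (truncate_seq n (fun i => Z i a)) n.+1.
  by move=> i ni; rewrite /truncate_seq leqNgt ni.
rewrite (phi_profile R zn)// /tail_sum; congr (_ <= Posz _).
by apply: eq_big_nat => i /andP[_ ni]; rewrite /truncate_seq -ltnS ni.
Qed.

Lemma truncated_level_measurable n t :
  level_measurable (fun a => phi R (truncate_seq n (fun i => Z i a)) t).
Proof.
move=> k; pose W a := phi R (truncate_seq n (fun i => Z i a)) t.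
have mge j : measurable [set a | (j <= W a)%N].
  have [->|j0] := posnP j; first by rewrite (_ : mkset _ = setT)//; apply/seteqP; split.
  rewrite (_ : mkset _ = (fun a => \sum_(j <= i < n.+1) Z i a)%N @^-1`
     [set s : nat | t + j%:Z <= s%:Z]).
    apply/preimage_measurable/sum_level_measurable => i; exact: Z_level_measurable.
  by apply/seteqP; split => a /=; rewrite /W truncated_profile.
rewrite (_ : mkset _ = [set a | (k <= W a)%N] `\` [set a | (k.+1 <= W a)%N]).
  exact: measurableD.
apply/seteqP; split => a /=; rewrite -/(W a); first by move=> ->; split=> //; rewrite ltnn.
by case=> h /negP; rewrite -leqNgt => h'; apply/eqP; rewrite eqn_leq h h'.
Qed.

(** With [k = a + l] and [M = b + l], the path is at [k] iff the tail sum [S]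
    above [k] is at most [M] and, unless [k = 0], [Z k >= M - S].  Summing over
    the value [m] of [S] and using [P (Z k >= M - m) = x^(k (M - m))] leaves the
    sum of [x^m qmultichoose N m] for [m <= M], which is [qmultichoose N.+1 M]. *)
Lemma truncated_law a b v l : (l <= v)%N ->
  prob P [set w | phi R (truncate_seq (a + v) (fun i => Z i w)) (b%:Z - a%:Z) = (a + l)%N]
  = durfee_law x a b v l.
Proof.
move=> lv; set k := (a + l)%N; set M := (b + l)%N; set N := (v - l)%N.
have nE : (a + v = k + N)%N by rewrite /k /N; lia.
rewrite nE.
pose S w := (\sum_(k.+1 <= i < (k + N).+1) Z i w)%N.
pose W w := phi R (truncate_seq (k + N) (fun i => Z i w)) (b%:Z - a%:Z).
have WS w : (k.+1 <= W w)%N = (M < S w)%N.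
  by rewrite /W truncated_profile// -/(S w) /k /M; lia.
have WZ w : (k <= W w)%N = (k == 0%N) || (M <= Z k w + S w)%N.
  have [->|k0] /= := eqVneq k 0%N; first by rewrite leq0n.
  rewrite /W truncated_profile ?lt0n// (big_ltn (m := k)) ?ltnS ?leq_addr// -/(S w) /k /M; lia.
rewrite -[mkset _]/[set w | W w = k].
have mW : measurable [set w | W w = k] by exact: truncated_level_measurable.
have -> : [set w | W w = k] = [set w | W w = k] `&` [set w | (S w < M.+1)%N].
  apply/seteqP; split=> [w /= Wk|w []//]; split=> //.
  by rewrite ltnS leqNgt -WS Wk ltnn.
rewrite prob_slices//; last first.
  by apply: sum_level_measurable => i; exact: Z_level_measurable.
pose B m i := if i == k then [set c | (M - m <= c)%N] else setT.
have slice (m : 'I_M.+1) : prob P ([set w | W w = k] `&` [set w | S w = m]) =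
    x ^+ (k * (M - m)) * (qprod x k.+1 (k + N).+1 * x ^+ (k.+1 * m) * qmultichoose x N m).
  have -> : [set w | W w = k] `&` [set w | S w = m] = cylinder k (B m) `&` [set w | S w = m].
    apply/seteqP; split=> w [/= h1 h2]; split=> //=.
      move=> i ik; rewrite /B; case: eqP => // ei; rewrite /= ei.
      by have := WZ w; rewrite h1 leqnn; lia.
    apply/eqP; rewrite eqn_leq; apply/andP; split.
      by rewrite leqNgt WS h2; have := ltn_ord m; lia.
    rewrite WZ; have [//|k0] := eqVneq k 0%N; rewrite /=.
    have := h1 k; rewrite /B eqxx /= h2; lia.
  rewrite prob_cylinder_sum; congr (_ * _); rewrite prob_cylinder.
  case: (posnP k) => [k0|k0]; first by rewrite k0 big_geq// mul0n.
  rewrite big_nat_recr//= big_nat_cond big1 ?mul1r.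
    by rewrite /B eqxx; apply: prob_Z_ge.
  move=> i /andP[/andP[i1 ik] _]; rewrite /B; case: eqP => [?|_]; first by lia.
  by rewrite preimage_setT probT.
rewrite (eq_bigr _ (fun c _ => slice c)).
transitivity (x ^+ (k * M) * qprod x k.+1 (k + N).+1 * qmultichoose x N.+1 M).
  rewrite [qmultichoose x N.+1 M]/= mulr_sumr; apply: eq_bigr => m _.
  have -> : x ^+ (k * M) = x ^+ (k * (M - m)) * x ^+ (k * m).
    by rewrite -exprD -mulnDr subnK// -ltnS.
  by rewrite mulSn exprD; ring.
rewrite qprod_qpoch// qmultichooseE// /durfee_law -/k -/M -/N -nE.
have -> : (b + v = N + M)%N by rewrite /N /M; lia.
have := qpoch_neq0 x0 x1 k; have := qpoch_neq0 x0 x1 N; have := qpoch_neq0 x0 x1 M.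
by move=> h1 h2 h3; field; rewrite h1 h2 h3.
Qed.

End geometric_family.

(** * The countdown of the whole sequence *)

Section untruncated.
Context d (T : measurableType d) (R : realType) (P : probability T R) (x : R)
  (Z : nat -> {RV P >-> nat}).
Hypotheses (x0 : 0 < x) (x1 : x < 1)
  (Z_indep : independent_RVs [set i | (1 <= i)%N] Z)
  (Z_law : forall i k : nat, (1 <= i)%N ->
     P [set a | (k <= Z i a)%N] = (x ^+ (i * k))%:E).

Definition nonzero_after (n : nat) : set T :=
  \bigcup_(k in [set k | (n <= k)%N]) [set a | (1 <= Z k.+1 a)%N].

Lemma nonzero_measurable i : measurable [set a | (1 <= Z i a)%N].
Proof. exact/(preimage_measurable [set m | (1 <= m)%N])/Z_level_measurable. Qed.

Lemma nonzero_after_measurable n : measurable (nonzero_after n).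
Proof. by apply: bigcup_measurable => k _; exact: nonzero_measurable. Qed.

(** Borel-Cantelli, as [P (Z i >= 1) = x^i] is summable. *)
Lemma prob_nonzero_after_cvg : prob P (nonzero_after n) @[n --> \oo] --> (0 : R).
Proof.
pose F k := [set a | (1 <= Z k.+1 a)%N].
have mF k : measurable (F k) by exact: nonzero_measurable.
have limsup0 : P (lim_sup_set F) = 0%E.
  apply: lim_sup_set_cvg0 => //.
  apply: (@le_lt_trans _ _ (x / (1 - x))%:E); last exact: ltry.
  apply: lime_le; first by apply: is_cvg_nneseries => *; exact: measure_ge0.
  apply: nearW => n; rewrite (eq_bigr (fun k => (x ^+ k.+1)%:E)); last first.
    by move=> k _; have := @Z_law k.+1 1 isT; rewrite muln1.
  rewrite sumEFin lee_fin.
  have -> : \sum_(0 <= k < n) x ^+ k.+1 = (x - x ^+ n.+1) / (1 - x).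
    elim: n => [|n IH]; first by rewrite big_geq// expr1 subrr mul0r.
    have xx : 1 - x != 0 by rewrite subr_eq0 eq_sym lt_eqF.
    by rewrite big_nat_recr//= IH [x ^+ n.+2]exprS; field.
  by rewrite ler_pM2r ?invr_gt0 ?subr_gt0// gerBl exprn_ge0 ?ltW.
have Poo : (P (nonzero_after 0) < +oo)%E.
  by apply: le_lt_trans (probability_le1 _ _) (ltry 1); exact: nonzero_after_measurable.
have h : P (nonzero_after n) @[n --> \oo] --> 0%E.
  by rewrite -limsup0; exact: lim_sup_set_cvg.
exact: (fine_cvg h).
Qed.

Lemma phi_off_nonzero_after n a : ~ nonzero_after n a ->
  phi R (fun i => Z i a) = phi R (truncate_seq n (fun i => Z i a)).
Proof.
move=> bad; congr phi; apply/funext => i; rewrite /truncate_seq.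
case: leqP => // ni; apply/eqP; rewrite -leqn0 leqNgt; apply/negP => Zi.
by apply: bad; exists i.-1 => /=; rewrite ?prednK//; lia.
Qed.

(** Off [nonzero_after n] the path equals its truncation at [n], and where all of
    these events occur it has the default value 0. *)
Lemma phi_level_measurable t : level_measurable (fun a => phi R (fun i => Z i a) t).
Proof.
move=> k; pose Xn n a := phi R (truncate_seq n (fun i => Z i a)) t.
rewrite (_ : mkset _ = \bigcup_n (~` nonzero_after n `&` [set a | Xn n a = k])
    `|` (\bigcap_n nonzero_after n `&` [set a | 0%N = k])).
  apply: measurableU.
    apply: bigcupT_measurable => n; apply: measurableI.
      exact/measurableC/nonzero_after_measurable.
    exact: truncated_level_measurable.
  apply: measurableI.
    by apply: bigcapT_measurable => n; exact: nonzero_after_measurable.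
  have [->|k0] := pselect (0%N = k).
    by rewrite (_ : mkset _ = setT)//; apply/seteqP; split.
  by rewrite (_ : mkset _ = set0)//; apply/seteqP; split.
have always a : (\bigcap_n nonzero_after n) a -> phi R (fun i => Z i a) = fun=> 0%N.
  move=> bad; apply: phi_default => N zN; have [i /= Ni] := bad N I.
  by rewrite zN//; lia.
apply/seteqP; split=> [a /= Xk|a [[n _ [nb]]|[bad]] /=].
- have [bad|/existsNP[n /not_implyP[_ nb]]] := pselect (forall n, True -> nonzero_after n a).
    by right; split=> //=; rewrite -Xk always.
  by left; exists n => //; split=> //=; rewrite /Xn -phi_off_nonzero_after.
- by rewrite /Xn -phi_off_nonzero_after.
- by rewrite always.
Qed.

(** The two events differ only inside [nonzero_after n]. *)
Lemma phi_atom_cvg t k :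
  prob P [set a | phi R (truncate_seq n (fun i => Z i a)) t = k] @[n --> \oo] -->
  prob P [set a | phi R (fun i => Z i a) t = k].
Proof.
apply/cvgrPdist_lt => e e0.
have /cvgrPdist_lt /(_ e e0) := prob_nonzero_after_cvg.
apply: filterS => n; rewrite sub0r normrN ger0_norm ?prob_ge0//; apply: le_lt_trans.
apply: prob_dist.
- exact: phi_level_measurable.
- exact: truncated_level_measurable.
- exact: nonzero_after_measurable.
- by apply/seteqP; split=> a /= [h nb]; split=> //; move: h; rewrite (phi_off_nonzero_after nb).
Qed.

Lemma phi_law_cvg a b l :
  durfee_law x a b v l @[v --> \oo] -->
  prob P [set w | phi R (fun i => Z i w) (b%:Z - a%:Z) = (a + l)%N].
Proof.
have := @phi_atom_cvg (b%:Z - a%:Z) (a + l); rewrite -(cvg_shiftn a) => h.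
apply: cvg_trans h; apply: near_eq_cvg; exists l => // v /= lv.
by rewrite addnC (truncated_law x0 x1 Z_indep Z_law).
Qed.

(** The path at time [b - a] is at least [a], and its truncation at [a + v] is at
    most [a + v].  For [a < k <= a + v] the mass at [k] increases along the
    truncations to that of the whole path, so [dTV_atom] applies at [a]. *)
Lemma dTV_countdown a b v : x <= 1 / 2 -> a = 0%N \/ b = 0%N ->
  dTV P (fun w => phi R (fun i => Z i w) (b%:Z - a%:Z))
        (fun w => phi R (truncate_seq (a + v) (fun i => Z i w)) (b%:Z - a%:Z)) =
  qprod x (a + b).+1 (a + b + v).+1 * (1 - qprod_inf x (a + b + v).+1).
Proof.
move=> xhalf ab; set t := b%:Z - a%:Z.
have mX := @phi_level_measurable t; have mXn := @truncated_level_measurable _ _ _ _ Z (a + v) t.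
rewrite (@dTV_atom _ _ _ _ _ _ a mX mXn); last first.
  move=> k ka.
  have profile w j := @truncated_profile _ _ _ _ Z (a + v) w j t.
  have empty : ((k < a) || (a + v < k))%N ->
      prob P [set w | phi R (truncate_seq (a + v) (fun i => Z i w)) t = k] = 0.
    move=> kout; rewrite (_ : mkset _ = set0) ?prob0//; apply/seteqP; split=> // w /= Wk.
    case/orP: kout => [ka'|nk].
      have := profile w a ltac:(lia); rewrite Wk /t; lia.
    by have := profile w k ltac:(lia); rewrite Wk leqnn big_geq// /t; lia.
  have [kout|] := boolP ((k < a) || (a + v < k))%N; first by rewrite empty ?prob_ge0.
  rewrite negb_or -!leqNgt => /andP[ak kn].
  pose l := (k - a)%N; have kE : k = (a + l)%N by rewrite /l; lia.
  have l0 : (0 < l)%N by rewrite /l; lia.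
  have lv : (l <= v)%N by rewrite /l; lia.
  rewrite kE (truncated_law x0 x1 Z_indep Z_law)//.
  have incr := @phi_law_cvg a b l.
  have := cvgr_to_ge incr; apply; exists v => // u /= vu.
  have -> : u = (v + (u - v))%N by lia.
  elim: (u - v)%N => [|m IH]; first by rewrite addn0.
  by apply: le_trans IH _; rewrite addnS; apply: durfee_law_incr => //; lia.
have -> : prob P [set w | phi R (fun i => Z i w) t = a] = qprod_inf x (a + b).+1.
  have := @phi_law_cvg a b 0; rewrite addn0 => /cvg_lim <- //; apply: cvg_lim => //.
  have : qprod x (a + b).+1 (v + (a + b).+1)%N @[v --> \oo] --> qprod_inf x (a + b).+1.
    by have := qprod_cvg x0 x1 (ltn0Sn (a + b)); rewrite -(cvg_shiftn (a + b).+1).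
  apply: cvg_trans; apply: near_eq_cvg; apply: nearW => u /=.
  by rewrite durfee_law0// [(u + _)%N]addnC addSn.
have := truncated_law x0 x1 Z_indep Z_law a b (leq0n v); rewrite addn0 => ->.
by rewrite durfee_law0// qprod_gap.
Qed.
End untruncated.

(** * Nonnegative and negative times *)

Theorem theorem6p2 (R : realType) (d : measure_display) (T : measurableType d)
  (P : probability T R) (x : R) (Z : nat -> {RV P >-> nat})
  (hx0 : 0 < x) (hx : x <= 1 / 2)
  (Z_indep : independent_RVs [set i | (1 <= i)%N] Z)
  (Z_law : forall i k : nat, (1 <= i)%N ->
     P [set a | (k <= Z i a)%N] = (x ^+ (i * k))%:E) :
  let X (t : int) (a : T) : nat := phi R (fun i => Z i a) t in
  let Xn (n : nat) (t : int) (a : T) : nat :=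
    phi R (truncate_seq n (fun i => Z i a)) t in
  let C (t : nat) : R := qprod_inf x t.+1 in
  [/\ forall n t : nat,
        dTV P (X t%:Z) (Xn n t%:Z) =
        (\prod_(t + 1 <= i < (n + t).+1) (1 - x ^+ i)) *
        (1 - qprod_inf x (n + t + 1)),
      forall t : nat,
        asymp_equiv (fun n : nat => dTV P (X t%:Z) (Xn n t%:Z))
          (fun n : nat => C t / (1 - x) * x ^+ (n + t + 1)),
      forall (t : int) (n : nat), t < 0 -> 0 <= n%:Z + t ->
        dTV P (X t) (Xn n t) =
        (\prod_(`|t|%N + 1 <= i < n.+1) (1 - x ^+ i)) *
        (1 - qprod_inf x (n + 1)) &
      forall t : int, t < 0 ->
        asymp_equiv (fun n : nat => dTV P (X t) (Xn n t))
          (fun n : nat => C `|t|%N / (1 - x) * x ^+ (n + 1))].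
Proof.
move=> X Xn C.
have x1 : x < 1 by apply: le_lt_trans hx _; lra.
(* Times [t >= 0] are [t - 0], times [t < 0] are [0 - |t|]. *)
have nonneg n t : dTV P (X t%:Z) (Xn n t%:Z) =
    qprod x t.+1 (t + n).+1 * (1 - qprod_inf x (t + n).+1).
  have := dTV_countdown hx0 x1 Z_indep Z_law n hx (or_introl (erefl 0%N)) (b := t).
  by rewrite !add0n subr0.
have neg s v : dTV P (X (- s%:Z)) (Xn (s + v)%N (- s%:Z)) =
    qprod x s.+1 (s + v).+1 * (1 - qprod_inf x (s + v).+1).
  have := dTV_countdown hx0 x1 Z_indep Z_law v hx (or_intror (erefl 0%N)) (a := s).
  by rewrite !addn0 sub0r.
split.
- by move=> n t; rewrite nonneg !addn1 addnC.
- move=> t; rewrite (_ : (fun n => dTV _ _ _) = fun n =>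
    qprod x t.+1 (t + n).+1 * (1 - qprod_inf x (t + n).+1)); last first.
    by apply/funext => n; exact: nonneg.
  rewrite (_ : (fun n : nat => C t / _ * _) = fun n : nat =>
    C t / (1 - x) * x ^+ (t + n).+1); last first.
    by apply/funext => n; rewrite addn1 [(n + t)%N]addnC.
  exact: qprod_asymp.
- move=> t n t0 nt.
  have -> : t = - `|t|%N%:Z by lia.
  have -> : n = (`|t|%N + (n - `|t|%N))%N by lia.
  by rewrite neg !addn1 abszN absz_nat.
- move=> t t0; have tE : t = - `|t|%N%:Z by lia.
  rewrite /asymp_equiv -(cvg_shiftn `|t|%N).
  apply: cvg_trans (qprod_asymp hx0 x1 `|t|%N hx).
  apply: near_eq_cvg; apply: nearW => v /=.
  by rewrite -neg -tE addn1 addnC.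
Qed.
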